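(* Let $a,b_1,b_2,c,t_1,t_2\in\mathbb{C}$, let $k_1,k_2,s\in\mathbb{N}$, and let $x,y\in\mathbb{C}$ with $|x|<1$, $|y|<1$. Assume $\Re(c)\ne 0,-1,-2,\dots$ (and, in (5), also $\Re(c-s)\neq 0,-1,-2,\dots$). Then each of the following recursion formulas holds whenever all the double series $\mathcal{F}_1^{(1)}$ occurring in it converge absolutely: (1) $$\begin{aligned}&\mathcal{F}_1^{(1)}(a+s,b_1,b_2;c;t_1,t_2,k_1,k_2,x,y)=\mathcal{F}_1^{(1)}(a,b_1,b_2;c;t_1,t_2,k_1,k_2,x,y)\\&\quad+\frac{(-1)^{k_1}(-t_1)_{k_1}b_1x}{c}\sum_{r=1}^{s}\mathcal{F}_1^{(1)}(a+r,b_1+1,b_2;c+1;t_1-k_1,t_2,k_1,k_2,x,y)\\&\quad+\frac{(-1)^{k_2}(-t_2)_{k_2}b_2y}{c}\sum_{r=1}^{s}\mathcal{F}_1^{(1)}(a+r,b_1,b_2+1;c+1;t_1,t_2-k_2,k_1,k_2,x,y);\end{aligned}$$ (2) $$\begin{aligned}&\mathcal{F}_1^{(1)}(a-s,b_1,b_2;c;t_1,t_2,k_1,k_2,x,y)=\mathcal{F}_1^{(1)}(a,b_1,b_2;c;t_1,t_2,k_1,k_2,x,y)\\&\quad-\frac{(-1)^{k_1}(-t_1)_{k_1}b_1x}{c}\sum_{r=0}^{s-1}\mathcal{F}_1^{(1)}(a-r,b_1+1,b_2;c+1;t_1-k_1,t_2,k_1,k_2,x,y)\\&\quad-\frac{(-1)^{k_2}(-t_2)_{k_2}b_2y}{c}\sum_{r=0}^{s-1}\mathcal{F}_1^{(1)}(a-r,b_1,b_2+1;c+1;t_1,t_2-k_2,k_1,k_2,x,y);\end{aligned}$$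 (3) $$\begin{aligned}&\mathcal{F}_1^{(1)}(a,b_1+s,b_2;c;t_1,t_2,k_1,k_2,x,y)=\mathcal{F}_1^{(1)}(a,b_1,b_2;c;t_1,t_2,k_1,k_2,x,y)\\&\quad+\frac{(-1)^{k_1}(-t_1)_{k_1}a\,x}{c}\sum_{r=1}^{s}\mathcal{F}_1^{(1)}(a+1,b_1+r,b_2;c+1;t_1-k_1,t_2,k_1,k_2,x,y);\end{aligned}$$ (4) $$\begin{aligned}&\mathcal{F}_1^{(1)}(a,b_1-s,b_2;c;t_1,t_2,k_1,k_2,x,y)=\mathcal{F}_1^{(1)}(a,b_1,b_2;c;t_1,t_2,k_1,k_2,x,y)\\&\quad-\frac{(-1)^{k_1}(-t_1)_{k_1}a\,x}{c}\sum_{r=0}^{s-1}\mathcal{F}_1^{(1)}(a+1,b_1-r,b_2;c+1;t_1-k_1,t_2,k_1,k_2,x,y);\end{aligned}$$ (5) $$\begin{aligned}&\mathcal{F}_1^{(1)}(a,b_1,b_2;c-s;t_1,t_2,k_1,k_2,x,y)=\mathcal{F}_1^{(1)}(a,b_1,b_2;c;t_1,t_2,k_1,k_2,x,y)\\&\quad+(-1)^{k_1}(-t_1)_{k_1}a\,b_1x\sum_{r=1}^{s}\frac{\mathcal{F}_1^{(1)}(a+1,b_1+1,b_2;c+2-r;t_1-k_1,t_2,k_1,k_2,x,y)}{(c-r)(c-r+1)}\\&\quad+(-1)^{k_2}(-t_2)_{k_2}a\,b_2y\sum_{r=1}^{s}\frac{\mathcal{F}_1^{(1)}(a+1,b_1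,b_2+1;c+2-r;t_1,t_2-k_2,k_1,k_2,x,y)}{(c-r)(c-r+1)}.\end{aligned}$$
   Context: $\mathbb{N}=\{1,2,3,\dots\}$. The Pochhammer symbol is $(u)_0=1$, $(u)_k=u(u+1)\cdots(u+k-1)$ for $k\ge1$. The first discrete Appell function is $$\mathcal{F}_1^{(1)}(a,b_1,b_2;c;t_1,t_2,k_1,k_2,x,y)=\sum_{m,n\ge 0}\frac{(a)_{m+n}(b_1)_m(b_2)_n(-1)^{mk_1}(-1)^{nk_2}(-t_1)_{mk_1}(-t_2)_{nk_2}}{(c)_{m+n}\,m!\,n!}x^my^n ,$$ where the denominator parameter $c$ is required to satisfy $\Re(c)\neq 0,-1,-2,\dots$. *)

(* Defs.v *)
From Stdlib Require Export Reals Factorial.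
From Coquelicot Require Export Coquelicot.

Open Scope C_scope.

(* A double series is summed as the limit of its rectangular partial sums, the
   two upper indices tending to infinity independently.  Under absolute
   convergence every other order of summation gives the same value. *)
Definition is_double_series {K : AbsRing} {V : NormedModule K}
    (u : nat -> nat -> V) (l : V) : Prop :=
  filterlim (fun p : nat * nat => sum_n (fun m => sum_n (u m) (snd p)) (fst p))
    (filter_prod eventually eventually) (locally l).

Definition double_series_abs_cv (u : nat -> nat -> C) : Prop :=
  exists l : R, is_double_series (fun m n => Cmod (u m n)) l.

(* Total: the value is unspecified when the double series diverges. *)
Definition double_series (u : nat -> nat -> C) : C :=
  iota (fun l : C_CompleteNormedModule => is_double_series u l).

Fixpoint pochhammer (u : C) (k : nat) : C :=
  match k with
  | O => 1
  | S j => pochhammer u j * (u + INR j)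
  end.

Definition re_not_nonpos_int (c : C) : Prop := forall j : nat, Re c <> (- INR j)%R.

Definition appellF1_term (a b1 b2 c t1 t2 : C) (k1 k2 : nat) (x y : C)
    (m n : nat) : C :=
  (pochhammer a (m + n) * pochhammer b1 m * pochhammer b2 n
    * (-(1)) ^ (m * k1) * (-(1)) ^ (n * k2)
    * pochhammer (- t1) (m * k1) * pochhammer (- t2) (n * k2))
  / (pochhammer c (m + n) * INR (fact m) * INR (fact n))
  * x ^ m * y ^ n.

Definition appellF1 (a b1 b2 c t1 t2 : C) (k1 k2 : nat) (x y : C) : C :=
  double_series (appellF1_term a b1 b2 c t1 t2 k1 k2 x y).

Definition appellF1_abs_cv (a b1 b2 c t1 t2 : C) (k1 k2 : nat) (x y : C) : Prop :=
  double_series_abs_cv (appellF1_term a b1 b2 c t1 t2 k1 k2 x y).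

(* Main.v *)
From Stdlib Require Import Lia Lra.
Require Import Defs.

(** With [N = m + n], the contiguous relations
    [(a+1)_N = (a)_N + N (a+1)_(N-1)], its analogue for [b1], and
    [1/(c)_N = 1/(c+1)_N + N / (c (c+1)_N)] are, after splitting [N = m + n],
    identities between the general terms: raising one parameter by one adds a
    multiple of a term with shifted parameters and index [m-1] or [n-1].  Such an
    index shift does not change the sum of a double series.  So each formula
    telescopes from one convergent series, using only that absolute convergence
    implies convergence of the rectangular partial sums. *)

(** * Rectangular partial sums of double series and index shifts *)

Section DoubleSeries.

Context {K : AbsRing} {V : NormedModule K}.

Definition rect_sum (u : nat -> nat -> V) (p : nat * nat) : V :=
  sum_n (fun m => sum_n (u m) (snd p)) (fst p).

Definition shift_l (u : nat -> nat -> V) (m n : nat) : V :=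
  match m with O => zero | S m' => u m' n end.

Definition shift_r (u : nat -> nat -> V) (m n : nat) : V :=
  match n with O => zero | S n' => u m n' end.

Lemma rect_sum_Sl (u : nat -> nat -> V) (M N : nat) :
  rect_sum u (S M, N) = plus (rect_sum u (M, N)) (sum_n (u (S M)) N).
Proof. apply sum_Sn. Qed.

Lemma rect_sum_Sr (u : nat -> nat -> V) (M N : nat) :
  rect_sum u (M, S N) = plus (rect_sum u (M, N)) (sum_n (fun m => u m (S N)) M).
Proof.
  unfold rect_sum; simpl.
  rewrite <- sum_n_plus; apply sum_n_ext; intros m; apply sum_Sn.
Qed.

Lemma rect_sum_plus (u v : nat -> nat -> V) (p : nat * nat) :
  rect_sum (fun m n => plus (u m n) (v m n)) p = plus (rect_sum u p) (rect_sum v p).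
Proof.
  unfold rect_sum; rewrite <- sum_n_plus.
  apply sum_n_ext; intros m; apply sum_n_plus.
Qed.

Lemma rect_sum_scal (a : K) (u : nat -> nat -> V) (p : nat * nat) :
  rect_sum (fun m n => scal a (u m n)) p = scal a (rect_sum u p).
Proof.
  unfold rect_sum.
  transitivity (sum_n (fun m => scal a (sum_n (u m) (snd p))) (fst p)).
  - apply sum_n_ext; intros m; exact (sum_n_m_scal_l a (u m) 0 (snd p)).
  - exact (sum_n_m_scal_l a (fun m => sum_n (u m) (snd p)) 0 (fst p)).
Qed.

Lemma sum_n_shift (v : nat -> V) (n : nat) :
  sum_n (fun i => match i with O => zero | S j => v j end) (S n) = sum_n v n.
Proof.
  unfold sum_n; rewrite sum_Sn_m by lia.
  rewrite plus_zero_l, <- sum_n_m_S; reflexivity.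
Qed.

Lemma rect_sum_shift_l (u : nat -> nat -> V) (M N : nat) :
  rect_sum (shift_l u) (S M, N) = rect_sum u (M, N).
Proof.
  unfold rect_sum; simpl.
  rewrite <- (sum_n_shift (fun m => sum_n (u m) N)).
  apply sum_n_ext; intros [|m]; simpl; [|reflexivity].
  apply sum_n_m_const_zero.
Qed.

Lemma rect_sum_shift_r (u : nat -> nat -> V) (M N : nat) :
  rect_sum (shift_r u) (M, S N) = rect_sum u (M, N).
Proof.
  unfold rect_sum; simpl; apply sum_n_ext; intros m.
  rewrite <- (sum_n_shift (u m)); apply sum_n_ext; intros [|n]; reflexivity.
Qed.

Lemma filterlim_pred_eventually : filterlim pred eventually eventually.
Proof.
  intros P [N HN]; exists (S N); intros n Hn; apply HN; lia.
Qed.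

Lemma is_double_series_ext (u v : nat -> nat -> V) (l : V) :
  (forall m n, u m n = v m n) -> is_double_series u l -> is_double_series v l.
Proof.
  intros Huv; apply filterlim_ext; intros p.
  apply sum_n_ext; intros m; apply sum_n_ext; intros n; apply Huv.
Qed.

Lemma is_double_series_plus (u v : nat -> nat -> V) (lu lv : V) :
  is_double_series u lu -> is_double_series v lv ->
  is_double_series (fun m n => plus (u m n) (v m n)) (plus lu lv).
Proof.
  intros Hu Hv.
  apply (filterlim_ext (fun p => plus (rect_sum u p) (rect_sum v p))).
  { intros p; symmetry; apply rect_sum_plus. }
  exact (filterlim_comp_2 _ _ _ Hu Hv (filterlim_plus lu lv)).
Qed.

Lemma is_double_series_scal (a : K) (u : nat -> nat -> V) (l : V) :
  is_double_series u l -> is_double_series (fun m n => scal a (u m n)) (scal a l).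
Proof.
  intros Hu.
  apply (filterlim_ext (fun p => scal a (rect_sum u p))).
  { intros p; symmetry; apply rect_sum_scal. }
  exact (filterlim_comp _ _ _ _ _ _ _ _ Hu (filterlim_scal_r a l)).
Qed.

(** A zero row placed in front only delays the rectangular sums by one in the first index, and
    [pred] tends to infinity, so the limit is the same. *)
Lemma is_double_series_shift_l (u : nat -> nat -> V) (l : V) :
  is_double_series u l -> is_double_series (shift_l u) l.
Proof.
  intros Hu.
  (* The two functions agree only from first index 1 on: at 0, [pred 0 = 0] keeps the first row of
     [u], while the shifted sum is zero. *)
  apply (filterlim_ext_loc (fun p => rect_sum u (pred (fst p), snd p))).
  { exists (fun m => (1 <= m)%nat) (fun _ => True).
    - exists 1%nat; auto.
    - exists 0%nat; auto.
    - intros [|m] n Hm _; [lia|]; symmetry; apply rect_sum_shift_l. }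
  refine (filterlim_comp _ _ _ _ _ _ _ _ _ Hu).
  apply filterlim_pair; [|apply filterlim_snd].
  exact (filterlim_comp _ _ _ _ _ _ _ _ filterlim_fst filterlim_pred_eventually).
Qed.

Lemma is_double_series_shift_r (u : nat -> nat -> V) (l : V) :
  is_double_series u l -> is_double_series (shift_r u) l.
Proof.
  intros Hu.
  apply (filterlim_ext_loc (fun p => rect_sum u (fst p, pred (snd p)))).
  { exists (fun _ => True) (fun n => (1 <= n)%nat).
    - exists 0%nat; auto.
    - exists 1%nat; auto.
    - intros m [|n] _ Hn; [lia|]; symmetry; apply rect_sum_shift_r. }
  refine (filterlim_comp _ _ _ _ _ _ _ _ _ Hu).
  apply filterlim_pair; [apply filterlim_fst|].
  exact (filterlim_comp _ _ _ _ _ _ _ _ filterlim_snd filterlim_pred_eventually).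
Qed.

End DoubleSeries.

(** * Absolute convergence implies convergence of rectangular sums *)

Section AbsoluteConvergence.

Context {K : AbsRing} {V : NormedModule K}.

Lemma norm_sum_n_le (v : nat -> V) (n : nat) :
  (norm (sum_n v n) <= sum_n (fun i => norm (v i)) n)%R.
Proof. apply norm_sum_n_m. Qed.

(** The bounds are increments of a real quantity, so that estimates along consecutive steps of a
    path telescope. *)
Lemma norm_minus_trans (x y z : V) (a b c : R) :
  (norm (minus y x) <= b - a)%R -> (norm (minus z y) <= c - b)%R ->
  (norm (minus z x) <= c - a)%R.
Proof.
  intros H1 H2; rewrite (minus_trans y z x).
  eapply Rle_trans; [apply norm_triangle|]; lra.
Qed.

Lemma minus_plus_cancel (x y : V) : minus (plus x y) x = y.
Proof.
  unfold minus; rewrite (plus_comm x y), <- plus_assoc.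
  etransitivity; [apply f_equal, plus_opp_r | apply plus_zero_r].
Qed.

(** Walk from the corner [(M, N)] to the larger one by unit steps, first in the second index, then
    in the first. Each step adds a segment of one row or column, whose norm is at most the same
    segment of the norms; these increments add up along the path. *)
Lemma norm_rect_sum_le (u : nat -> nat -> V) (M N i j : nat) :
  (norm (minus (rect_sum u (i + M, j + N)%nat) (rect_sum u (M, N)))
   <= rect_sum (fun m n => norm (u m n)) (i + M, j + N)%nat
      - rect_sum (fun m n => norm (u m n)) (M, N))%R.
Proof.
  assert (Hl : forall M N, (norm (minus (rect_sum u (S M, N)) (rect_sum u (M, N)))
     <= rect_sum (fun m n => norm (u m n)) (S M, N)
        - rect_sum (fun m n => norm (u m n)) (M, N))%R).
  { intros M' N'; rewrite !rect_sum_Sl, minus_plus_cancel.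
    unfold plus at 1; simpl; rewrite Rplus_minus_l; apply norm_sum_n_le. }
  assert (Hr : forall M N, (norm (minus (rect_sum u (M, S N)) (rect_sum u (M, N)))
     <= rect_sum (fun m n => norm (u m n)) (M, S N)
        - rect_sum (fun m n => norm (u m n)) (M, N))%R).
  { intros M' N'; rewrite !rect_sum_Sr, minus_plus_cancel.
    unfold plus at 1; simpl; rewrite Rplus_minus_l; apply norm_sum_n_le. }
  induction i as [|i IH]; simpl.
  - induction j as [|j IH]; simpl.
    + right; rewrite Rminus_diag.
      rewrite (minus_eq_zero (rect_sum u (M, N))); exact norm_zero.
    + exact (norm_minus_trans _ _ _ _ _ _ IH (Hr _ _)).
  - exact (norm_minus_trans _ _ _ _ _ _ IH (Hl _ _)).
Qed.

End AbsoluteConvergence.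

(** By completeness a Cauchy estimate suffices: beyond some corner the rectangular sums of [u] vary
    no more than those of the norms, which converge. *)
Lemma ex_double_series_norm {K : AbsRing} {V : CompleteNormedModule K}
    (u : nat -> nat -> V) (L : R) :
  is_double_series (fun m n => norm (u m n)) L -> exists l : V, is_double_series u l.
Proof.
  intros HL.
  apply (proj1 (filterlim_locally_cauchy (F := filter_prod eventually eventually)
    (rect_sum u))).
  intros eps.
  set (A := rect_sum (fun m n => norm (u m n))).
  (* Two norm sums within [eps / 4] of [L] differ by less than [eps / 2]; two rectangular sums of
     [u] are then compared through the common corner [(M, N)], at a cost of [eps / 2] each. *)
  assert (Hhalf : (0 < eps / 4)%R) by (generalize (cond_pos eps); lra).
  destruct (proj1 (filterlim_locally _ _) HL (mkposreal _ Hhalf))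
    as [P Q [M HM] [N HN] HPQ].
  assert (HA : forall m n, (M <= m)%nat -> (N <= n)%nat ->
      (Rabs (A (m, n) - L) < eps / 4)%R).
  { intros m n Hm Hn; exact (HPQ m n (HM m Hm) (HN n Hn)). }
  assert (HS : forall m n, (M <= m)%nat -> (N <= n)%nat ->
      (norm (minus (rect_sum u (m, n)) (rect_sum u (M, N))) < eps / 2)%R).
  { intros m n Hm Hn.
    generalize (norm_rect_sum_le u M N (m - M) (n - N)).
    replace (m - M + M)%nat with m by lia; replace (n - N + N)%nat with n by lia.
    fold A.
    assert (H1 := HA m n Hm Hn); assert (H2 := HA M N (le_n _) (le_n _)).
    apply Rabs_def2 in H1; apply Rabs_def2 in H2; lra. }
  exists (fun p => (M <= fst p)%nat /\ (N <= snd p)%nat); split.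
  { exists (fun m => (M <= m)%nat) (fun n => (N <= n)%nat).
    - exists M; auto.
    - exists N; auto.
    - auto. }
  intros [m n] [m' n'] [H1 H2] [H3 H4]; simpl in *.
  refine (norm_compat1 (V := CompleteNormedModule.NormedModule K V) _ _ _ _).
  rewrite (minus_trans (rect_sum u (M, N))).
  eapply Rle_lt_trans; [apply norm_triangle|].
  rewrite <- (opp_minus (rect_sum u (m, n)) (rect_sum u (M, N))), norm_opp.
  generalize (HS m n H1 H2) (HS m' n' H3 H4); lra.
Qed.

(** * Values of complex double series and telescoping *)

Lemma double_series_unique (u : nat -> nat -> C) (l : C) :
  is_double_series (V := C_CompleteNormedModule) u l -> double_series u = l.
Proof.
  intros H; exact (iota_filterlim_locally (V := C_CompleteNormedModule) _ _ H).
Qed.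

Lemma double_series_abs_cv_correct (u : nat -> nat -> C) :
  double_series_abs_cv u ->
  is_double_series (V := C_CompleteNormedModule) u (double_series u).
Proof.
  intros [L HL].
  destruct (ex_double_series_norm (V := C_CompleteNormedModule) u L HL) as [l Hl].
  rewrite (double_series_unique u l Hl); exact Hl.
Qed.

(** The termwise recurrence carries convergence from [F r] to [F (S r)] together with the value, so
    the intermediate series converge by induction from the first one. The start is given by an
    equation [F O = f] because in the uses [F O] has a parameter such as [a + INR 0], equal to [a]
    but not convertible to it. *)
Lemma double_series_telescope (F U V : nat -> nat -> nat -> C)
    (f : nat -> nat -> C) (A B : C) (lU lV : nat -> C) (s : nat) :
  F O = f -> double_series_abs_cv f ->
  (forall r, (r <= s)%nat -> is_double_series (V := C_CompleteNormedModule) (U r) (lU r)) ->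
  (forall r, (r <= s)%nat -> is_double_series (V := C_CompleteNormedModule) (V r) (lV r)) ->
  (forall r m n, (r <= s)%nat -> F (S r) m n
     = F r m n + A * U r m n + B * V r m n) ->
  double_series (F (S s))
  = double_series f + A * sum_n_m lU 0 s + B * sum_n_m lV 0 s.
Proof.
  intros <- H0 HU HV HF; apply double_series_unique.
  assert (Hstep : forall r l, (r <= s)%nat ->
     is_double_series (V := C_CompleteNormedModule) (F r) l ->
     is_double_series (V := C_CompleteNormedModule) (F (S r))
       (l + A * lU r + B * lV r)).
  { intros r l Hr Hl.
    eapply is_double_series_ext; [intros m n; symmetry; apply HF, Hr|].
    refine (is_double_series_plus (V := C_CompleteNormedModule) _ _ _ _
      (is_double_series_plus (V := C_CompleteNormedModule) _ _ _ _ Hl _) _);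
      refine (is_double_series_scal (V := C_CompleteNormedModule) _ _ _ _).
    - apply HU, Hr.
    - apply HV, Hr. }
  apply double_series_abs_cv_correct in H0.
  clear HU HV HF; induction s as [|s IH].
  - rewrite !sum_n_n; apply Hstep; auto.
  - rewrite !sum_n_Sm by lia.
    match goal with |- is_double_series _ ?l => replace l with
      (double_series (F O) + A * sum_n_m lU 0 s + B * sum_n_m lV 0 s
       + A * lU (S s) + B * lV (S s))
      by (unfold plus; simpl; ring) end.
    apply Hstep; auto.
Qed.

(** * Admissible denominator parameters and Pochhammer symbols *)

Lemma re_not_nonpos_int_neq0 (c : C) : re_not_nonpos_int c -> c <> 0.
Proof.
  intros Hc ->; apply (Hc O); simpl; lra.
Qed.

Lemma re_not_nonpos_int_plus1 (c : C) : re_not_nonpos_int c -> re_not_nonpos_int (c + 1).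
Proof.
  intros Hc j Hj; apply (Hc (S j)); rewrite S_INR; unfold Re in *; simpl in *; lra.
Qed.

(** If the real part of [c - r] were [-j], that of [c - s] would be [-(s - r + j)]. This makes every
    intermediate denominator parameter in (5) admissible. *)
Lemma re_not_nonpos_int_minus (c : C) (r s : nat) :
  (r <= s)%nat -> re_not_nonpos_int (c - INR s) -> re_not_nonpos_int (c - INR r).
Proof.
  intros Hrs Hc j Hj; apply (Hc (s - r + j)%nat).
  rewrite plus_INR, minus_INR by lia; unfold Re in *; simpl in *; lra.
Qed.

Lemma RtoC_S_INR (n : nat) : RtoC (INR (S n)) = RtoC (INR n) + 1.
Proof. rewrite S_INR, RtoC_plus; reflexivity. Qed.

Lemma RtoC_INR_S_neq0 (n : nat) : RtoC (INR (S n)) <> 0.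
Proof. intros H; apply RtoC_inj in H; revert H; apply not_0_INR; discriminate. Qed.

Lemma RtoC_fact_neq0 (n : nat) : RtoC (INR (fact n)) <> 0.
Proof. intros H; apply RtoC_inj in H; revert H; apply INR_fact_neq_0. Qed.

Lemma pochhammer_add (u : C) (j k : nat) :
  pochhammer u (j + k) = pochhammer u j * pochhammer (u + INR j) k.
Proof.
  induction k as [|k IH]; simpl.
  - rewrite Nat.add_0_r; ring.
  - rewrite Nat.add_succ_r; simpl; rewrite IH, plus_INR, RtoC_plus; ring.
Qed.

Lemma pochhammer_Sl (u : C) (k : nat) : pochhammer u (S k) = u * pochhammer (u + 1) k.
Proof.
  change (S k) with (1 + k)%nat; rewrite pochhammer_add; simpl; ring.
Qed.

Lemma pochhammer_neq0 (c : C) (k : nat) : re_not_nonpos_int c -> pochhammer c k <> 0.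
Proof.
  intros Hc; induction k as [|k IH]; simpl.
  - intros H; apply RtoC_inj in H; lra.
  - apply Cmult_neq_0; [exact IH|]; intros H.
    apply (Hc k); apply (f_equal Re) in H; unfold Re in *; simpl in *; lra.
Qed.

(** * The general term: one-index factors, Pochhammer relations, index shifts *)

(** The part of the general term in one index, without the Pochhammer symbol of [b1] or [b2]. Once
    index shifts are absorbed, this factor is common to all terms of a contiguous relation, whereas
    the [b] symbols change. *)
Definition appell_factor (t : C) (k : nat) (x : C) (m : nat) : C :=
  (-(1)) ^ (m * k) * pochhammer (- t) (m * k) / INR (fact m) * x ^ m.

(** The multiplier cancels the last factor of the factorial, and the first [k] factors of the
    Pochhammer symbol split off, leaving one that starts at [- t + k]. This is the origin of the
    shift from [t] to [t - k]. *)
Lemma appell_factor_S (t : C) (k : nat) (x : C) (m : nat) :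
  INR (S m) * appell_factor t k x (S m)
  = (-(1)) ^ k * pochhammer (- t) k * x * appell_factor (t - INR k) k x m.
Proof.
  unfold appell_factor.
  change (S m * k)%nat with (k + m * k)%nat.
  rewrite pochhammer_add, Cpow_add_r, fact_simpl, mult_INR, RtoC_mult, Cpow_S.
  replace (- (t - INR k)) with (- t + INR k) by ring.
  field; split; [apply RtoC_fact_neq0 | apply RtoC_INR_S_neq0].
Qed.

Lemma appellF1_term_eq (a b1 b2 c t1 t2 : C) (k1 k2 : nat) (x y : C) (m n : nat) :
  re_not_nonpos_int c ->
  appellF1_term a b1 b2 c t1 t2 k1 k2 x y m n
  = pochhammer a (m + n) / pochhammer c (m + n) * pochhammer b1 m * pochhammer b2 n
    * appell_factor t1 k1 x m * appell_factor t2 k2 y n.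
Proof.
  intros Hc; unfold appellF1_term, appell_factor; field.
  repeat split; auto using RtoC_fact_neq0, pochhammer_neq0.
Qed.

(* At [N = 0] the value [pred 0 = 0] is harmless, since the factor [N] vanishes. *)
Lemma pochhammer_plus1_l (u : C) (N : nat) :
  pochhammer (u + 1) N = pochhammer u N + INR N * pochhammer (u + 1) (pred N).
Proof.
  destruct N as [|N]; [simpl; ring|].
  rewrite (pochhammer_Sl u); simpl pred; rewrite RtoC_S_INR; simpl; ring.
Qed.

(** Both [c (c+1)_N] and [(c)_N (c+N)] equal [(c)_(N+1)], so [1/(c)_N = (c+N) / (c (c+1)_N)]; the
    numerator is then split. *)
Lemma inv_pochhammer_plus1 (c : C) (N : nat) :
  re_not_nonpos_int c ->
  / pochhammer c N = / pochhammer (c + 1) N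
     + INR N / (c * pochhammer (c + 1) N).
Proof.
  intros Hc; assert (H0 := re_not_nonpos_int_neq0 _ Hc).
  assert (H1 := pochhammer_neq0 _ N (re_not_nonpos_int_plus1 _ Hc)).
  assert (H2 := pochhammer_neq0 _ N Hc).
  assert (E : c * pochhammer (c + 1) N = pochhammer c N * (c + INR N)).
  { rewrite <- pochhammer_Sl; reflexivity. }
  assert (H3 : c + INR N <> 0).
  { intros H; apply (Cmult_neq_0 _ _ H0 H1); rewrite E, H; ring. }
  replace (pochhammer c N) with (c * pochhammer (c + 1) N / (c + INR N)).
  - field; auto.
  - rewrite E; field; auto.
Qed.

(** The rule [(u)_N = u (u+1)_(N-1)] needs [N >= 1]; with [pred 0 = 0], the factor [N] makes it
    valid for all [N] without a case split. The next lemma is its counterpart for denominators. *)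
Lemma INR_mult_pochhammer (u : C) (N : nat) :
  INR N * (u * pochhammer (u + 1) (pred N)) = INR N * pochhammer u N.
Proof.
  destruct N as [|N]; [simpl; ring|].
  rewrite (pochhammer_Sl u); reflexivity.
Qed.

Lemma INR_div_pochhammer (c : C) (N : nat) :
  INR N / (c * pochhammer (c + 1) (pred N)) = INR N / pochhammer c N.
Proof.
  destruct N as [|N]; [unfold Cdiv; simpl; ring|].
  rewrite (pochhammer_Sl c); reflexivity.
Qed.

(** Rewrites the shifted term with the one-index factors of the unshifted one. The zero row
    corresponds to the multiplier [m]; for positive [m], [appell_factor_S] absorbs the prefactor and
    the shift of [t1]. *)
Lemma appellF1_term_shift_l (a b1 b2 c t1 t2 : C) (k1 k2 : nat) (x y : C) (m n : nat) :
  re_not_nonpos_int c ->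
  (-(1)) ^ k1 * pochhammer (- t1) k1 * x
    * shift_l (V := C_CompleteNormedModule)
        (appellF1_term a b1 b2 c (t1 - INR k1) t2 k1 k2 x y) m n
  = INR m * (pochhammer a (pred (m + n)) / pochhammer c (pred (m + n))
      * pochhammer b1 (pred m) * pochhammer b2 n
      * appell_factor t1 k1 x m * appell_factor t2 k2 y n).
Proof.
  intros Hc; destruct m as [|m]; cbn [shift_l].
  - change (INR 0) with 0%R; rewrite Cmult_0_l; exact (Cmult_0_r _).
  - rewrite appellF1_term_eq by exact Hc; cbn [pred Nat.add].
    transitivity (INR (S m) * appell_factor t1 k1 x (S m)
      * (pochhammer a (m + n) / pochhammer c (m + n) * pochhammer b1 m
         * pochhammer b2 n * appell_factor t2 k2 y n)); [|ring].
    rewrite appell_factor_S; ring.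
Qed.

(** The symmetry exchanging the two variables, by which the statement on [shift_r] follows from the
    one on [shift_l]. *)
Lemma appellF1_term_swap (a b1 b2 c t1 t2 : C) (k1 k2 : nat) (x y : C) (m n : nat) :
  appellF1_term a b1 b2 c t1 t2 k1 k2 x y m n
  = appellF1_term a b2 b1 c t2 t1 k2 k1 y x n m.
Proof.
  unfold appellF1_term, Cdiv; rewrite (Nat.add_comm n m).
  (* [ring] treats the inverted denominator as an atom, so the factorials inside it are first put in
     the same order. *)
  rewrite <- (Cmult_assoc _ (RtoC (INR (fact n)))), (Cmult_comm (RtoC (INR (fact n)))),
    Cmult_assoc.
  ring.
Qed.

Lemma appellF1_term_shift_r (a b1 b2 c t1 t2 : C) (k1 k2 : nat) (x y : C) (m n : nat) :
  re_not_nonpos_int c ->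
  (-(1)) ^ k2 * pochhammer (- t2) k2 * y
    * shift_r (V := C_CompleteNormedModule)
        (appellF1_term a b1 b2 c t1 (t2 - INR k2) k1 k2 x y) m n
  = INR n * (pochhammer a (pred (m + n)) / pochhammer c (pred (m + n))
      * pochhammer b1 m * pochhammer b2 (pred n)
      * appell_factor t1 k1 x m * appell_factor t2 k2 y n).
Proof.
  intros Hc.
  replace (shift_r (V := C_CompleteNormedModule) _ m n)
    with (shift_l (V := C_CompleteNormedModule)
      (appellF1_term a b2 b1 c (t2 - INR k2) t1 k2 k1 y x) n m).
  - rewrite appellF1_term_shift_l, (Nat.add_comm n m) by exact Hc; ring.
  - destruct n as [|n]; simpl; [reflexivity | apply appellF1_term_swap].
Qed.

(** * Contiguous relations between general terms *)

(** The correction [N (a+1)_(N-1)] is split along [N = m + n]. The coefficient [b1 / c] arises from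
    [m (b1)_m = m b1 (b1+1)_(m-1)] and [N/(c)_N = N / (c (c+1)_(N-1))]; likewise [b2 / c]. *)
Lemma appellF1_term_a_plus1 (a b1 b2 c t1 t2 : C) (k1 k2 : nat) (x y : C) (m n : nat) :
  re_not_nonpos_int c ->
  appellF1_term (a + 1) b1 b2 c t1 t2 k1 k2 x y m n
  = appellF1_term a b1 b2 c t1 t2 k1 k2 x y m n
    + (-(1)) ^ k1 * pochhammer (- t1) k1 * b1 * x / c
      * shift_l (V := C_CompleteNormedModule)
          (appellF1_term (a + 1) (b1 + 1) b2 (c + 1) (t1 - INR k1) t2 k1 k2 x y) m n
    + (-(1)) ^ k2 * pochhammer (- t2) k2 * b2 * y / c
      * shift_r (V := C_CompleteNormedModule)
          (appellF1_term (a + 1) b1 (b2 + 1) (c + 1) t1 (t2 - INR k2) k1 k2 x y) m n.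
Proof.
  intros Hc; assert (Hc1 := re_not_nonpos_int_plus1 _ Hc).
  assert (H0 := re_not_nonpos_int_neq0 _ Hc).
  assert (EL := appellF1_term_shift_l (a + 1) (b1 + 1) b2 (c + 1) t1 t2 k1 k2 x y m n Hc1).
  assert (ER := appellF1_term_shift_r (a + 1) b1 (b2 + 1) (c + 1) t1 t2 k1 k2 x y m n Hc1).
  rewrite !appellF1_term_eq by exact Hc.
  set (SL := shift_l _ m n) in *; set (SR := shift_r _ m n) in *.
  replace (_ * b1 * x / c * SL) with (b1 / c * ((-(1)) ^ k1 * pochhammer (- t1) k1 * x * SL))
    by (unfold Cdiv; ring).
  replace (_ * b2 * y / c * SR) with (b2 / c * ((-(1)) ^ k2 * pochhammer (- t2) k2 * y * SR))
    by (unfold Cdiv; ring).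
  rewrite EL, ER, pochhammer_plus1_l.
  assert (HN : RtoC (INR (m + n)) = INR m + INR n) by (rewrite plus_INR, RtoC_plus; reflexivity).
  assert (HD := INR_div_pochhammer c (m + n)).
  assert (Em := INR_mult_pochhammer b1 m); assert (En := INR_mult_pochhammer b2 n).
  set (p := pochhammer (c + 1) _) in *.
  set (q := pochhammer (a + 1) _) in *.
  assert (Hp : p <> 0) by (apply pochhammer_neq0, Hc1).
  set (A1 := appell_factor t1 k1 x m); set (A2 := appell_factor t2 k2 y n).
  (* Isolates [N/(c)_N], to be rewritten before [N] is split; the second [transitivity] isolates
     [m (b1)_m] and [n (b2)_n]. *)
  transitivity (pochhammer a (m + n) / pochhammer c (m + n) * pochhammer b1 m * pochhammer b2 n * A1 * A2
    + INR (m + n) / pochhammer c (m + n) * (q * pochhammer b1 m * pochhammer b2 n * A1 * A2)).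
  { unfold Cdiv; ring. }
  rewrite <- HD, HN.
  transitivity (pochhammer a (m + n) / pochhammer c (m + n) * pochhammer b1 m * pochhammer b2 n * A1 * A2
    + (INR m * pochhammer b1 m) * (q * pochhammer b2 n * A1 * A2) / (c * p)
    + (INR n * pochhammer b2 n) * (q * pochhammer b1 m * A1 * A2) / (c * p)).
  { unfold Cdiv; ring. }
  rewrite <- Em, <- En; field; repeat split; auto using pochhammer_neq0.
Qed.

Lemma appellF1_term_b1_plus1 (a b1 b2 c t1 t2 : C) (k1 k2 : nat) (x y : C) (m n : nat) :
  re_not_nonpos_int c ->
  appellF1_term a (b1 + 1) b2 c t1 t2 k1 k2 x y m n
  = appellF1_term a b1 b2 c t1 t2 k1 k2 x y m n
    + (-(1)) ^ k1 * pochhammer (- t1) k1 * a * x / c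
      * shift_l (V := C_CompleteNormedModule)
          (appellF1_term (a + 1) (b1 + 1) b2 (c + 1) (t1 - INR k1) t2 k1 k2 x y) m n.
Proof.
  intros Hc; assert (Hc1 := re_not_nonpos_int_plus1 _ Hc).
  assert (EL := appellF1_term_shift_l (a + 1) (b1 + 1) b2 (c + 1) t1 t2 k1 k2 x y m n Hc1).
  rewrite !appellF1_term_eq by exact Hc.
  set (SL := shift_l _ m n) in *.
  replace (_ * a * x / c * SL) with (a / c * ((-(1)) ^ k1 * pochhammer (- t1) k1 * x * SL))
    by (unfold Cdiv; ring).
  rewrite EL, pochhammer_plus1_l.
  (* The correction has the factor [m] and vanishes at 0; otherwise [m + n] is a successor and the
     leading factors [a] and [c] can be peeled off. *)
  destruct m as [|m]; [simpl; unfold Cdiv; ring|].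
  cbn [Nat.add pred]; rewrite (pochhammer_Sl a), (pochhammer_Sl c).
  field; auto using pochhammer_neq0, re_not_nonpos_int_neq0.
Qed.

(** The correction [N / (c (c+1)_N)] meets [N (a)_N = N a (a+1)_(N-1)] and
    [N/(c+1)_N = N / ((c+1) (c+2)_(N-1))], after which [N] is split. The weight [1/(c (c+1))] stays
    next to the shifted term because it varies when [c] moves, while the outer coefficient is
    constant in the telescoping. *)
Lemma appellF1_term_c_plus1 (a b1 b2 c t1 t2 : C) (k1 k2 : nat) (x y : C) (m n : nat) :
  re_not_nonpos_int c ->
  appellF1_term a b1 b2 c t1 t2 k1 k2 x y m n
  = appellF1_term a b1 b2 (c + 1) t1 t2 k1 k2 x y m n
    + (-(1)) ^ k1 * pochhammer (- t1) k1 * a * b1 * x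
      * (/ (c * (c + 1)) * shift_l (V := C_CompleteNormedModule)
          (appellF1_term (a + 1) (b1 + 1) b2 (c + 1 + 1) (t1 - INR k1) t2 k1 k2 x y) m n)
    + (-(1)) ^ k2 * pochhammer (- t2) k2 * a * b2 * y
      * (/ (c * (c + 1)) * shift_r (V := C_CompleteNormedModule)
          (appellF1_term (a + 1) b1 (b2 + 1) (c + 1 + 1) t1 (t2 - INR k2) k1 k2 x y) m n).
Proof.
  intros Hc; assert (Hc1 := re_not_nonpos_int_plus1 _ Hc).
  assert (Hc2 := re_not_nonpos_int_plus1 _ Hc1).
  assert (H0 := re_not_nonpos_int_neq0 _ Hc); assert (H1 := re_not_nonpos_int_neq0 _ Hc1).
  assert (EL := appellF1_term_shift_l (a + 1) (b1 + 1) b2 (c + 1 + 1) t1 t2 k1 k2 x y m n Hc2).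
  assert (ER := appellF1_term_shift_r (a + 1) b1 (b2 + 1) (c + 1 + 1) t1 t2 k1 k2 x y m n Hc2).
  rewrite !appellF1_term_eq by assumption.
  set (SL := shift_l _ m n) in *; set (SR := shift_r _ m n) in *.
  set (w := / (c * (c + 1))).
  replace (_ * a * b1 * x * (w * SL))
    with (a * b1 * w * ((-(1)) ^ k1 * pochhammer (- t1) k1 * x * SL)) by ring.
  replace (_ * a * b2 * y * (w * SR))
    with (a * b2 * w * ((-(1)) ^ k2 * pochhammer (- t2) k2 * y * SR)) by ring.
  rewrite EL, ER; unfold Cdiv at 1; rewrite (inv_pochhammer_plus1 c) by exact Hc.
  assert (HN : RtoC (INR (m + n)) = INR m + INR n) by (rewrite plus_INR, RtoC_plus; reflexivity).
  assert (HD := INR_div_pochhammer (c + 1) (m + n)).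
  assert (Ea := INR_mult_pochhammer a (m + n)).
  assert (Em := INR_mult_pochhammer b1 m); assert (En := INR_mult_pochhammer b2 n).
  assert (Hp := pochhammer_neq0 _ (pred (m + n)) Hc2).
  assert (HP := pochhammer_neq0 _ (m + n) Hc1).
  set (p := pochhammer (c + 1 + 1) _) in *.
  set (q := pochhammer (a + 1) _) in *.
  set (A1 := appell_factor t1 k1 x m); set (A2 := appell_factor t2 k2 y n).
  set (P := pochhammer (c + 1) (m + n)) in *.
  transitivity (pochhammer a (m + n) / P * pochhammer b1 m * pochhammer b2 n * A1 * A2
    + (INR (m + n) * pochhammer a (m + n)) / P
      * (pochhammer b1 m * pochhammer b2 n * A1 * A2 / c)).
  { field; auto. }
  rewrite <- Ea.
  transitivity (pochhammer a (m + n) / P * pochhammer b1 m * pochhammer b2 n * A1 * A2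
    + INR (m + n) / P * (a * q * pochhammer b1 m * pochhammer b2 n * A1 * A2 / c)).
  { unfold Cdiv; ring. }
  rewrite <- HD, HN.
  transitivity (pochhammer a (m + n) / P * pochhammer b1 m * pochhammer b2 n * A1 * A2
    + (INR m * pochhammer b1 m) * (a * q * pochhammer b2 n * A1 * A2) * w / p
    + (INR n * pochhammer b2 n) * (a * q * pochhammer b1 m * A1 * A2) * w / p).
  { unfold w; field; auto. }
  rewrite <- Em, <- En; unfold Cdiv; ring.
Qed.

(** * Telescoping to the five recursion formulas *)

Theorem theorem6p1 :
  forall (a b1 b2 c t1 t2 : C) (k1 k2 s : nat) (x y : C),
  (1 <= k1)%nat -> (1 <= k2)%nat -> (1 <= s)%nat ->
  (Cmod x < 1)%R -> (Cmod y < 1)%R ->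
  re_not_nonpos_int c ->
  (* (1) *)
  (appellF1_abs_cv (a + INR s) b1 b2 c t1 t2 k1 k2 x y ->
   appellF1_abs_cv a b1 b2 c t1 t2 k1 k2 x y ->
   (forall r : nat, (1 <= r <= s)%nat ->
      appellF1_abs_cv (a + INR r) (b1 + 1) b2 (c + 1) (t1 - INR k1) t2 k1 k2 x y) ->
   (forall r : nat, (1 <= r <= s)%nat ->
      appellF1_abs_cv (a + INR r) b1 (b2 + 1) (c + 1) t1 (t2 - INR k2) k1 k2 x y) ->
   appellF1 (a + INR s) b1 b2 c t1 t2 k1 k2 x y
   = appellF1 a b1 b2 c t1 t2 k1 k2 x y
     + (-(1)) ^ k1 * pochhammer (- t1) k1 * b1 * x / c
       * sum_n_m (fun r =>
           appellF1 (a + INR r) (b1 + 1) b2 (c + 1) (t1 - INR k1) t2 k1 k2 x y) 1 s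
     + (-(1)) ^ k2 * pochhammer (- t2) k2 * b2 * y / c
       * sum_n_m (fun r =>
           appellF1 (a + INR r) b1 (b2 + 1) (c + 1) t1 (t2 - INR k2) k1 k2 x y) 1 s)
  /\
  (* (2) *)
  (appellF1_abs_cv (a - INR s) b1 b2 c t1 t2 k1 k2 x y ->
   appellF1_abs_cv a b1 b2 c t1 t2 k1 k2 x y ->
   (forall r : nat, (0 <= r <= s - 1)%nat ->
      appellF1_abs_cv (a - INR r) (b1 + 1) b2 (c + 1) (t1 - INR k1) t2 k1 k2 x y) ->
   (forall r : nat, (0 <= r <= s - 1)%nat ->
      appellF1_abs_cv (a - INR r) b1 (b2 + 1) (c + 1) t1 (t2 - INR k2) k1 k2 x y) ->
   appellF1 (a - INR s) b1 b2 c t1 t2 k1 k2 x y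
   = appellF1 a b1 b2 c t1 t2 k1 k2 x y
     - (-(1)) ^ k1 * pochhammer (- t1) k1 * b1 * x / c
       * sum_n_m (fun r =>
           appellF1 (a - INR r) (b1 + 1) b2 (c + 1) (t1 - INR k1) t2 k1 k2 x y)
           0 (s - 1)
     - (-(1)) ^ k2 * pochhammer (- t2) k2 * b2 * y / c
       * sum_n_m (fun r =>
           appellF1 (a - INR r) b1 (b2 + 1) (c + 1) t1 (t2 - INR k2) k1 k2 x y)
           0 (s - 1))
  /\
  (* (3) *)
  (appellF1_abs_cv a (b1 + INR s) b2 c t1 t2 k1 k2 x y ->
   appellF1_abs_cv a b1 b2 c t1 t2 k1 k2 x y ->
   (forall r : nat, (1 <= r <= s)%nat ->
      appellF1_abs_cv (a + 1) (b1 + INR r) b2 (c + 1) (t1 - INR k1) t2 k1 k2 x y) ->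
   appellF1 a (b1 + INR s) b2 c t1 t2 k1 k2 x y
   = appellF1 a b1 b2 c t1 t2 k1 k2 x y
     + (-(1)) ^ k1 * pochhammer (- t1) k1 * a * x / c
       * sum_n_m (fun r =>
           appellF1 (a + 1) (b1 + INR r) b2 (c + 1) (t1 - INR k1) t2 k1 k2 x y) 1 s)
  /\
  (* (4) *)
  (appellF1_abs_cv a (b1 - INR s) b2 c t1 t2 k1 k2 x y ->
   appellF1_abs_cv a b1 b2 c t1 t2 k1 k2 x y ->
   (forall r : nat, (0 <= r <= s - 1)%nat ->
      appellF1_abs_cv (a + 1) (b1 - INR r) b2 (c + 1) (t1 - INR k1) t2 k1 k2 x y) ->
   appellF1 a (b1 - INR s) b2 c t1 t2 k1 k2 x y
   = appellF1 a b1 b2 c t1 t2 k1 k2 x y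
     - (-(1)) ^ k1 * pochhammer (- t1) k1 * a * x / c
       * sum_n_m (fun r =>
           appellF1 (a + 1) (b1 - INR r) b2 (c + 1) (t1 - INR k1) t2 k1 k2 x y)
           0 (s - 1))
  /\
  (* (5) *)
  (re_not_nonpos_int (c - INR s) ->
   appellF1_abs_cv a b1 b2 (c - INR s) t1 t2 k1 k2 x y ->
   appellF1_abs_cv a b1 b2 c t1 t2 k1 k2 x y ->
   (forall r : nat, (1 <= r <= s)%nat ->
      appellF1_abs_cv (a + 1) (b1 + 1) b2 (c + 2 - INR r) (t1 - INR k1) t2 k1 k2 x y) ->
   (forall r : nat, (1 <= r <= s)%nat ->
      appellF1_abs_cv (a + 1) b1 (b2 + 1) (c + 2 - INR r) t1 (t2 - INR k2) k1 k2 x y) ->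
   appellF1 a b1 b2 (c - INR s) t1 t2 k1 k2 x y
   = appellF1 a b1 b2 c t1 t2 k1 k2 x y
     + (-(1)) ^ k1 * pochhammer (- t1) k1 * a * b1 * x
       * sum_n_m (fun r =>
           appellF1 (a + 1) (b1 + 1) b2 (c + 2 - INR r) (t1 - INR k1) t2 k1 k2 x y
           / ((c - INR r) * (c - INR r + 1))) 1 s
     + (-(1)) ^ k2 * pochhammer (- t2) k2 * a * b2 * y
       * sum_n_m (fun r =>
           appellF1 (a + 1) b1 (b2 + 1) (c + 2 - INR r) t1 (t2 - INR k2) k1 k2 x y
           / ((c - INR r) * (c - INR r + 1))) 1 s).
Proof.
  intros a b1 b2 c t1 t2 k1 k2 s x y _ _ Hs _ _ Hc.
  (* With [S s] for [s], sums from 1 to [S s] reindex to 0 to [s], and the upper bound [S s - 1]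
     becomes [s]: the range of [double_series_telescope]. *)
  destruct s as [|s]; [lia|]; clear Hs.
  rewrite Nat.sub_succ, Nat.sub_0_r.
  assert (Hl : forall u, double_series_abs_cv u ->
    is_double_series (V := C_CompleteNormedModule)
      (shift_l (V := C_CompleteNormedModule) u) (double_series u)).
  { intros u Hu; apply is_double_series_shift_l, double_series_abs_cv_correct, Hu. }
  assert (Hr : forall u, double_series_abs_cv u ->
    is_double_series (V := C_CompleteNormedModule)
      (shift_r (V := C_CompleteNormedModule) u) (double_series u)).
  { intros u Hu; apply is_double_series_shift_r, double_series_abs_cv_correct, Hu. }
  assert (Hadd0 : forall z : C, z + INR 0 = z) by (intros z; simpl; ring).
  assert (Hsub0 : forall z : C, z - INR 0 = z) by (intros z; simpl; ring).
  assert (HaddS : forall (z : C) r, z + INR (S r) = z + INR r + 1)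
    by (intros z r; rewrite RtoC_S_INR; ring).
  assert (HsubS : forall (z : C) r, z - INR r = z - INR (S r) + 1)
    by (intros z r; rewrite RtoC_S_INR; ring).
  assert (Hsubmul : forall z u v : C, z - u * v = z + - u * v) by (intros; ring).
  unfold appellF1, appellF1_abs_cv.
  split; [|split; [|split; [|split]]].
  - intros _ H0 HL HR; rewrite <- !sum_n_m_S.
    refine (double_series_telescope
      (fun r => appellF1_term (a + INR r) b1 b2 c t1 t2 k1 k2 x y)
      _ _ _ _ _ _ _ s _ H0 (fun r Hrs => Hl _ (HL (S r) ltac:(lia)))
      (fun r Hrs => Hr _ (HR (S r) ltac:(lia))) _).
    + cbv beta; rewrite Hadd0; reflexivity.
    + intros r m n _; cbv beta; rewrite HaddS; apply appellF1_term_a_plus1, Hc.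
  - intros _ H0 HL HR; rewrite !Hsubmul.
    refine (double_series_telescope
      (fun r => appellF1_term (a - INR r) b1 b2 c t1 t2 k1 k2 x y)
      _ _ _ _ _ _ _ s _ H0 (fun r Hrs => Hl _ (HL r ltac:(lia)))
      (fun r Hrs => Hr _ (HR r ltac:(lia))) _).
    + cbv beta; rewrite Hsub0; reflexivity.
    (* The raising relation is used at [a - (r+1)] and solved for its left neighbour. Its shifted
       terms carry [a - r], so the sums start at [r = 0]. *)
    + intros r m n _; cbv beta; rewrite (HsubS a r).
      rewrite (appellF1_term_a_plus1 (a - INR (S r))) by exact Hc; ring.
  - intros _ H0 HL; rewrite <- !sum_n_m_S.
    (* A zero multiple of the same sum is added, so that the telescoping with two sums applies with
       [B = 0] and [V = U]. *)
    match goal with |- _ = _ + _ * ?S =>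
      rewrite <- (Cplus_0_r (_ * S)), Cplus_assoc, <- (Cmult_0_l S) end.
    refine (double_series_telescope
      (fun r => appellF1_term a (b1 + INR r) b2 c t1 t2 k1 k2 x y)
      _ _ _ _ _ _ _ s _ H0 (fun r Hrs => Hl _ (HL (S r) ltac:(lia)))
      (fun r Hrs => Hl _ (HL (S r) ltac:(lia))) _).
    + cbv beta; rewrite Hadd0; reflexivity.
    + intros r m n _; cbv beta; rewrite HaddS.
      rewrite (appellF1_term_b1_plus1 a (b1 + INR r)) by exact Hc; ring.
  - intros _ H0 HL.
    rewrite Hsubmul; match goal with |- _ = _ + _ * ?S =>
      rewrite <- (Cplus_0_r (_ * S)), Cplus_assoc, <- (Cmult_0_l S) end.
    refine (double_series_telescope
      (fun r => appellF1_term a (b1 - INR r) b2 c t1 t2 k1 k2 x y)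
      _ _ _ _ _ _ _ s _ H0 (fun r Hrs => Hl _ (HL r ltac:(lia)))
      (fun r Hrs => Hl _ (HL r ltac:(lia))) _).
    + cbv beta; rewrite Hsub0; reflexivity.
    + intros r m n _; cbv beta; rewrite (HsubS b1 r).
      rewrite (appellF1_term_b1_plus1 a (b1 - INR (S r))) by exact Hc; ring.
  - intros Hcs _ H0 HL HR; rewrite <- !sum_n_m_S.
    refine (double_series_telescope
      (fun r => appellF1_term a b1 b2 (c - INR r) t1 t2 k1 k2 x y)
      (* The weights depend on [r] and therefore belong to the auxiliary series. *)
      (fun r m n => / ((c - INR (S r)) * (c - INR (S r) + 1))
        * shift_l (V := C_CompleteNormedModule) (appellF1_term (a + 1) (b1 + 1) b2
            (c + 2 - INR (S r)) (t1 - INR k1) t2 k1 k2 x y) m n)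
      (fun r m n => / ((c - INR (S r)) * (c - INR (S r) + 1))
        * shift_r (V := C_CompleteNormedModule) (appellF1_term (a + 1) b1 (b2 + 1)
            (c + 2 - INR (S r)) t1 (t2 - INR k2) k1 k2 x y) m n)
      _ _ _ _ _ s _ H0 _ _ _).
    + cbv beta; rewrite Hsub0; reflexivity.
    + intros r Hrs; unfold Cdiv; rewrite (Cmult_comm (double_series _)).
      apply (is_double_series_scal (V := C_CompleteNormedModule)), Hl, HL; lia.
    + intros r Hrs; unfold Cdiv; rewrite (Cmult_comm (double_series _)).
      apply (is_double_series_scal (V := C_CompleteNormedModule)), Hr, HR; lia.
    (* The relation at [c - (r+1)] already expresses the lower parameter through the higher one,
       which gives the plus signs. *)
    + intros r m n Hrs; cbv beta; rewrite (HsubS c r).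
      replace (c + 2 - INR (S r)) with (c - INR (S r) + 1 + 1) by ring.
      apply appellF1_term_c_plus1.
      refine (re_not_nonpos_int_minus c (S r) (S s) _ Hcs); lia.
Qed.
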